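(* Let $1<p<\infty$ and let $\mathbf{A}=\{a_n\}_{n\ge 1}\in NBVS$ be such that $$\sum_{n=1}^\infty n^{p-2}a_n^p<\infty .$$ If $f$ is the sum of either of the series $$\sum_{n=1}^\infty a_n\cos nx\qquad\text{or}\qquad \sum_{n=1}^\infty a_n\sin nx,$$ then there are positive constants $K_1,K_2$, independent of $n$, such that for all $n=1,2,\dots$ $$\omega_p(f,n^{-1})\le K_1 n^{-1}\left\{\sum_{\nu=1}^{n-1}\nu^{2p-2}a_\nu^p\right\}^{1/p}+K_2\left\{\sum_{\nu=n}^{\infty}\nu^{p-2}a_\nu^p\right\}^{1/p}.$$
   Context: A sequence $\mathbf{A}=\{a_n\}_{n\ge1}$ of nonnegative real numbers belongs to $NBVS$ if there is a constant $K(\mathbf{A})$, depending only on $\mathbf{A}$, such that $\sum_{m=n}^{2n}|\Delta a_m|\le K(\mathbf{A})(a_n+a_{2n})$ for all $n=1,2,\dots$, where $\Delta a_m=a_m-a_{m+1}$. $L^p$ is the space of $2\pi$-periodic functions that are $p$-power integrable over a period, with usual norm $\|\cdot\|_p$. For $f\in L^p$ and $h>0$, $\omega_p(f,h):=\sup_{|t|\le h}\|f(x+t)-f(x)\|_p$. Positive constants $K,K_1,K_2$ may depend on $p$ and $\mathbf{A}$. An empty sum is $0$. *)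

(* Defs.v *)
From HB Require Import structures.
From mathcomp Require Import all_boot all_order all_algebra.
From mathcomp Require Import all_classical all_reals all_analysis.
Set Implicit Arguments.
Unset Strict Implicit.
Unset Printing Implicit Defensive.
Import Order.TTheory GRing.Theory Num.Theory.
Import numFieldNormedType.Exports.
Local Open Scope classical_set_scope.
Local Open Scope ring_scope.

(* Sequences are indexed from 1 in all that follows: the term [a 0] is never
   constrained and never used. *)
Definition NBVS (R : realType) (a : nat -> R) : Prop :=
  (forall n, (1 <= n)%N -> 0 <= a n) /\
  exists K : R, forall n, (1 <= n)%N ->
    \sum_(n <= m < (2 * n).+1) `|a m - a m.+1| <= K * (a n + a (2 * n)%N).

Definition periodic2pi (R : realType) (f : R -> R) : Prop :=
  forall x, f (x + 2 * pi) = f x.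

(* [\_] extends by 0 outside [0, 2 * pi], so this is
   (\int_0^{2 pi} |f|^p)^{1/p}, possibly +oo. *)
Definition norm2pi (R : realType) (p : R) (f : R -> R) : \bar R :=
  ('N[ @lebesgue_measure R ]_(p%:E) [(EFin \o f) \_ `[0%R, (2 * pi)%R]])%E.

(* The value is an extended real, so that the modulus is defined for every
   measurable periodic function. *)
Definition modulus (R : realType) (p : R) (f : R -> R) (h : R) : \bar R :=
  ereal_sup [set norm2pi p (fun x => f (x + t) - f x) | t in [set t | `|t| <= h]].

(* Convergence is only required almost everywhere: under the hypotheses of the
   theorem the cosine series may diverge at the multiples of [2 * pi]. *)
Definition is_sum_cos (R : realType) (a : nat -> R) (f : R -> R) : Prop :=
  {ae @lebesgue_measure R, forall x,
    (fun N : nat => \sum_(1 <= n < N.+1) a n * cos (n%:R * x)) @ \oo --> f x}.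

Definition is_sum_sin (R : realType) (a : nat -> R) (f : R -> R) : Prop :=
  {ae @lebesgue_measure R, forall x,
    (fun N : nat => \sum_(1 <= n < N.+1) a n * sin (n%:R * x)) @ \oo --> f x}.

(* Main.v *)
Require Import Defs.
From HB Require Import structures.
From mathcomp Require Import all_boot all_order all_algebra.
From mathcomp Require Import all_classical all_reals all_analysis.
From mathcomp Require Import measurable_realfun.
From mathcomp Require Import ring lra.
Set Implicit Arguments.
Unset Strict Implicit.
Unset Printing Implicit Defensive.
Import Order.TTheory GRing.Theory Num.Theory.
Import numFieldNormedType.Exports.
Local Open Scope classical_set_scope.
Local Open Scope ring_scope.

(** The difference [f (x + t) - f x] is estimated pointwise, block by block, over
    the dyadic frequency ranges [L <= m < 2 * L], [L = 2 ^ i].  On a block the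
    coefficients of an NBVS sequence are bounded, and have bounded variation, in
    terms of [E_i = a L + a (2 * L)] alone ([nbvs_le], [nbvs_tvar]), so summation
    by parts bounds the block at [y] by a multiple of [E_i * peak L y], where
    [peak L y] is [min L (1 / |sin (y / 2)|)].  For
    [|t| <= 1 / n] and [L <= n] the product formula writes the difference of
    the block as a block at the midpoint [x + t / 2] whose coefficients carry an
    extra factor of order at most [L / n].  Hence, with
    [W_i = min (L / n) 1 * E_i], up to a constant,

      [|f (x + t) - f x| <= sum_i W_i * (peak L x + peak L (x + t / 2)
                                                  + peak L (x + t))]

    ([norm_block_diff]).

    Where [|sin (y / 2)|] is of order [2 ^ -j] the corresponding sum is of order
    [U_j = sum_i W_i * 2 ^ min i j], and in a period these points have measure of
    order [2 ^ -j] ([peak_dyadic], [measure_sin_sublevel]).  So the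
    integral of its [p]-th power is at most a multiple of
    [sum_j 2 ^ -j * U_j ^ p], which Schur's test for a geometric Toeplitz kernel
    bounds by a multiple of [sum_i W_i ^ p * 2 ^ (i * (p - 1))]
    ([dyadic_hardy], [integral_peak_sum_le]).

    Finally [a L] is controlled by [a k + a (2 * k)] for every [k] between
    [L / 2] and [L]; averaging over such [k] turns the dyadic sum back into
    [sum_k k ^ (p - 2) * (min (k / n) 1 * a k) ^ p] ([nbvs_dyadic_sum_le]), which
    is [n ^ -p] times the first sum of the theorem plus the second one.  The
    estimate is made for the partial sums of order [2 ^ M], uniformly in [M], and
    Fatou's lemma carries it over to [f]. *)

(** * Elementary bounds for the sine *)

Lemma norm_sinB (R : realType) (u v : R) : `|sin u - sin v| <= `|u - v|.
Proof.
wlog vu : u v / v <= u => [H|].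
  by have [/H//|/ltW/H] := leP v u; rewrite distrC [leRHS]distrC.
have [c _ ->] : exists2 c, c \in `[v, u] & sin u - sin v = cos c * (u - v).
  apply: MVT_segment => //.
  by apply: continuous_subspaceT => x; exact: continuous_sin.
by rewrite normrM ler_piMl ?cos_max.
Qed.

Lemma norm_sin_le (R : realType) (u : R) : `|sin u| <= `|u|.
Proof. by have := norm_sinB u 0; rewrite sin0 !subr0. Qed.

Lemma cos_ge1Bsqr (R : realType) (u : R) : 1 - u ^+ 2 / 2 <= cos u.
Proof.
have -> : cos u = 1 - 2 * sin (u / 2) ^+ 2.
  have -> : cos u = cos (u / 2 *+ 2) by congr cos; rewrite -mulr_natr divfK.
  by rewrite cos_mulr2n cos2sin2 -mulr_natr; ring.
have : `|sin (u / 2)| ^+ 2 <= `|u / 2| ^+ 2.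
  by rewrite lerXn2r ?nnegrE// norm_sin_le.
by rewrite !real_normK ?num_real//; lra.
Qed.

(** A crude form of Jordan's inequality; the value of the constant is
    immaterial. *)
Lemma ler_quarter_sin (R : realType) (u : R) : 0 <= u <= pi / 2 -> u / 4 <= sin u.
Proof.
move=> /andP[u0 upi].
have small (v : R) : 0 <= v <= 1 -> v / 2 <= sin v.
  move=> /andP[v0 v1].
  have [c cI] : exists2 c, c \in `[0, v] & sin v - sin 0 = cos c * (v - 0).
    apply: MVT_segment => //.
    by apply: continuous_subspaceT => x; exact: continuous_sin.
  rewrite sin0 !subr0 => ->.
  move: cI; rewrite in_itv/= => /andP[c0 cv].
  have c2 : 1 / 2 <= cos c by apply: le_trans (cos_ge1Bsqr c); nra.
  by nra.
have [u1|u1] := leP u 1; first by have := small u; rewrite u0 u1 => /(_ isT); lra.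
have := small 1; rewrite ler01 lexx => /(_ isT) s1.
have pi1 := @pihalf_ge1 R; have pi2 := @pihalf_lt2 R.
have : sin 1 < sin u by rewrite ltr_sin// in_itv/=; apply/andP; split; lra.
by lra.
Qed.

(** * Trigonometric sums with NBVS coefficients over a block [L, 2 L] *)

(** [trig true] is the cosine, [trig false] the sine: both kinds of series are
    treated simultaneously. *)
Definition trig (R : realType) (c : bool) (x : R) : R := if c then cos x else sin x.

Lemma norm_trig_le1 (R : realType) c (x : R) : `|trig c x| <= 1.
Proof. by case: c; rewrite /trig ?cos_max ?sin_max. Qed.

Lemma trig_sub_prod (R : realType) c (u v : R) :
  trig c (u + v) - trig c (u - v) = (-1) ^+ c * 2 * sin v * trig (~~ c) u.
Proof.
by case: c; rewrite /trig/= ?cosD ?sinD cosN sinN ?expr1 ?expr0; ring.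
Qed.

(** Multiplied by [2 * sin (y / 2)], the harmonics of [y] telescope. *)
Lemma trig_telescope (R : realType) c (y : R) (m : nat) :
  2 * sin (y / 2) * trig c (m%:R * y) =
  (-1) ^+ (~~ c) * (trig (~~ c) ((m.+1%:R - 2^-1) * y) -
                    trig (~~ c) ((m%:R - 2^-1) * y)).
Proof.
have -> : (m.+1%:R - 2^-1) * y = m%:R * y + y / 2.
  by rewrite -natr1; field.
have -> : (m%:R - 2^-1) * y = m%:R * y - y / 2 by field.
rewrite trig_sub_prod negbK.
by rewrite !mulrA -signr_addb addbb expr0 mul1r.
Qed.

(** The end values plus the total variation of [b] on [L, Q]; it bounds the
    sum of [b] against the increments of any sequence bounded by 1. *)
Definition tvar (R : realType) (b : nat -> R) (L Q : nat) : R :=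
  `|b L| + `|b Q| + \sum_(L <= m < Q) `|b m - b m.+1|.

Lemma norm_abel_sum (R : realType) (b S : nat -> R) (L Q : nat) :
  (L <= Q)%N -> (forall m, `|S m| <= 1) ->
  `|\sum_(L <= m < Q) b m * (S m.+1 - S m)| <= tvar b L Q.
Proof.
move=> LQ S1.
have -> : \sum_(L <= m < Q) b m * (S m.+1 - S m) =
    b Q * S Q - b L * S L + \sum_(L <= m < Q) (b m - b m.+1) * S m.+1.
  have <- := telescope_sumr (fun m => b m * S m) LQ.
  by rewrite -big_split/=; apply: eq_bigr => m _; ring.
have bS m : `|b m * S m| <= `|b m| by rewrite normrM ler_piMr.
rewrite (le_trans (ler_normD _ _))// /tvar lerD//.
  by rewrite (le_trans (ler_normB _ _))// addrC lerD.
rewrite (le_trans (ler_norm_sum _ _ _))// ler_sum// => m _.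
by rewrite normrM ler_piMr.
Qed.

Lemma norm_trig_sum (R : realType) c (b : nat -> R) (L Q : nat) (y : R) :
  (L <= Q)%N ->
  `|\sum_(L <= m < Q) b m * trig c (m%:R * y)| * `|sin (y / 2)| <= tvar b L Q.
Proof.
move=> LQ; rewrite -normrM.
have -> : (\sum_(L <= m < Q) b m * trig c (m%:R * y)) * sin (y / 2) =
  2^-1 * (-1) ^+ (~~ c) * \sum_(L <= m < Q) b m *
    (trig (~~ c) ((m.+1%:R - 2^-1) * y) - trig (~~ c) ((m%:R - 2^-1) * y)).
  rewrite mulr_suml mulr_sumr; apply: eq_bigr => m _.
  have -> : 2^-1 * (-1) ^+ (~~ c) * (b m *
     (trig (~~ c) ((m.+1%:R - 2^-1) * y) - trig (~~ c) ((m%:R - 2^-1) * y))) =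
   2^-1 * b m * ((-1) ^+ (~~ c) *
      (trig (~~ c) ((m.+1%:R - 2^-1) * y) - trig (~~ c) ((m%:R - 2^-1) * y))).
    ring.
  by rewrite -trig_telescope; field.
have /= := @norm_abel_sum R b (fun m => trig (~~ c) ((m%:R - 2^-1) * y)) L Q LQ
  (fun m => norm_trig_le1 _ _).
rewrite !normrM normr_sign mulr1 ger0_norm//.
set X := `|_|; set Y := tvar _ _ _.
have : 0 <= X by rewrite normr_ge0.
lra.
Qed.

(** This is [min L (1 / |sin (y / 2)|)], the size at [y] of a
    trigonometric sum over frequencies of order [L] with slowly varying
    coefficients of order 1. Taking the maximum before the inverse gives the
    correct value [L] at the zeros of the sine. *)
Definition peak (R : realType) (L : nat) (y : R) : R :=
  (Num.max L%:R^-1 `|sin (y / 2)|)^-1.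

Lemma peak_ge0 (R : realType) L (y : R) : 0 <= peak L y.
Proof. by rewrite invr_ge0 le_max normr_ge0 orbT. Qed.

Lemma le_mul_peak (R : realType) (B C : R) L (y : R) : (0 < L)%N -> 0 <= B ->
  B <= C * L%:R -> B * `|sin (y / 2)| <= C -> B <= C * peak L y.
Proof.
move=> L0 B0 BL BC.
have LR : 0 < L%:R^-1 :> R by rewrite invr_gt0 ltr0n.
rewrite /peak ler_pdivlMr ?lt_max ?LR//; case: (leP L%:R^-1) => // _.
by rewrite ler_pdivrMr ?ltr0n.
Qed.

(** The gain that a difference with step at most [1 / n] brings at the
    frequency [L]. *)
Definition lam (R : realType) (n L : nat) : R := Num.min (L%:R / n%:R) 1.

Section dyadic_block.
Variables (R : realType) (K : R) (a : nat -> R).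
Hypothesis a0 : forall m, (1 <= m)%N -> 0 <= a m.
Hypothesis aK : forall n, (1 <= n)%N ->
  \sum_(n <= m < (2 * n).+1) `|a m - a m.+1| <= K * (a n + a (2 * n)%N).
Hypothesis K0 : 0 <= K.

(** NBVS controls the whole block by its two end values. *)
Lemma nbvs_tvar L : (1 <= L)%N ->
  tvar a L (2 * L) <= (1 + K) * (a L + a (2 * L)%N).
Proof.
move=> L1; rewrite /tvar !ger0_norm ?a0 ?muln_gt0// mulrDl mul1r lerD2l.
apply: le_trans (aK L1); rewrite big_nat_recr//=; last by rewrite leq_pmull.
by rewrite lerDl.
Qed.

Lemma nbvs_le L k : (1 <= L)%N -> (L <= k <= 2 * L)%N ->
  a k <= (1 + K) * (a L + a (2 * L)%N).
Proof.
move=> L1 /andP[Lk kL].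
have := nbvs_tvar L1; apply: le_trans; rewrite /tvar.
have -> : a k = a L - \sum_(L <= m < k) (a m - a m.+1).
  have := telescope_sumr a Lk; under eq_bigr do rewrite -opprB.
  by rewrite sumrN => ->; rewrite addrC subrK.
rewrite (big_cat_nat Lk kL)/=.
have := ler_norm (- \sum_(L <= m < k) (a m - a m.+1)); rewrite normrN.
have := ler_norm_sum (index_iota L k) (fun m => a m - a m.+1) xpredT.
have := ler_norm (a L); have : 0 <= \sum_(k <= m < 2 * L) `|a m - a m.+1|.
  by rewrite sumr_ge0.
have := normr_ge0 (a (2 * L)%N).
lra.
Qed.

Lemma nbvs_sum_le L (w : nat -> R) : (1 <= L)%N ->
  (forall m, (L <= m < 2 * L)%N -> `|w m| <= 1) ->
  `|\sum_(L <= m < 2 * L) a m * w m| <= (1 + K) * (a L + a (2 * L)%N) * L%:R.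
Proof.
move=> L1 w1; rewrite (le_trans (ler_norm_sum _ _ _))//.
have -> : (1 + K) * (a L + a (2 * L)%N) * L%:R =
    \sum_(L <= m < 2 * L) ((1 + K) * (a L + a (2 * L)%N)).
  by rewrite sumr_const_nat mulr_natr mul2n -addnn addnK.
rewrite [X in _ <= X]big_nat [X in X <= _]big_nat ler_sum// => m /[dup] mL /w1 wm.
have /andP[Lm m2L] := mL.
rewrite normrM (@le_trans _ _ `|a m|) ?ler_piMr//.
by rewrite ger0_norm ?a0 ?(leq_trans L1)// nbvs_le// Lm ltnW.
Qed.

(** For high frequencies this bound is applied to the two values of the block
    separately. *)
Lemma norm_block_le c L y : (1 <= L)%N ->
  `|\sum_(L <= m < 2 * L) a m * trig c (m%:R * y)| <=
  (1 + K) * (a L + a (2 * L)%N) * peak L y.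
Proof.
move=> L1; apply: le_mul_peak => //.
  by apply: nbvs_sum_le => // m _; exact: norm_trig_le1.
apply: le_trans (nbvs_tvar L1).
by rewrite norm_trig_sum// leq_pmull.
Qed.

(** Low frequencies: by the product formula the difference is again a sum over
    the block, at the midpoint, with coefficients smaller by the factor
    [L / n] and of comparably smaller variation. *)
Lemma norm_block_diff_low c n L x t : (1 <= L)%N -> (L <= n)%N ->
  `|t| <= n%:R^-1 ->
  `|\sum_(L <= m < 2 * L) a m * (trig c (m%:R * (x + t)) - trig c (m%:R * x))|
  <= 3 * (1 + K) * (L%:R / n%:R) * (a L + a (2 * L)%N) * peak L (x + t / 2).
Proof.
move=> L1 Ln tn.
have n0 : 0 < n%:R :> R by rewrite ltr0n (leq_trans L1).
have LR : 1 <= L%:R :> R by rewrite ler1n.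
have E0 : 0 <= a L + a (2 * L)%N by rewrite addr_ge0 ?a0 ?muln_gt0.
pose E : R := (1 + K) * (a L + a (2 * L)%N).
have EE : 0 <= E by rewrite mulr_ge0// addr_ge0.
have rn0 : 0 <= L%:R / n%:R :> R by rewrite divr_ge0.
have diffE m : trig c (m%:R * (x + t)) - trig c (m%:R * x) =
    (-1) ^+ c * 2 * sin (m%:R * (t / 2)) * trig (~~ c) (m%:R * (x + t / 2)).
  by rewrite -trig_sub_prod; congr (trig c _ - trig c _); field.
have sinm m : `|2 * sin (m%:R * (t / 2))| <= m%:R / n%:R.
  rewrite normrM ger0_norm//.
  apply: (@le_trans _ _ (2 * `|m%:R * (t / 2)|)).
    by rewrite ler_wpM2l// norm_sin_le.
  rewrite !normrM ger0_norm// [`|2^-1|]ger0_norm//.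
  have : 0 <= m%:R :> R by [].
  move: tn; set T := `|t|; set N := n%:R^-1; nra.
pose b m : R := (-1) ^+ c * a m * (2 * sin (m%:R * (t / 2))).
have -> : \sum_(L <= m < 2 * L) a m * (trig c (m%:R * (x + t)) - trig c (m%:R * x))
    = \sum_(L <= m < 2 * L) b m * trig (~~ c) (m%:R * (x + t / 2)).
  by apply: eq_bigr => m _; rewrite diffE /b; ring.
have bm m : (1 <= m)%N -> (m <= 2 * L)%N -> `|b m| <= 2 * (L%:R / n%:R) * a m.
  move=> m1 mL; rewrite /b normrM normrM normr_sign mul1r ger0_norm ?a0//.
  rewrite mulrC ler_wpM2r ?a0// (le_trans (sinm m))// mulrA ler_pM2r ?invr_gt0//.
  by rewrite -natrM ler_nat.
have -> : 3 * (1 + K) * (L%:R / n%:R) * (a L + a (2 * L)%N) =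
          3 * (L%:R / n%:R) * E by rewrite /E; ring.
apply: le_mul_peak => //.
- apply: (@le_trans _ _ (\sum_(L <= m < 2 * L) 2 * (L%:R / n%:R) * E)).
    rewrite (le_trans (ler_norm_sum _ _ _))// [leLHS]big_nat [leRHS]big_nat.
    apply: ler_sum => m /andP[Lm mL].
    rewrite normrM (@le_trans _ _ `|b m|) ?ler_piMr ?norm_trig_le1//.
    rewrite (le_trans (bm m _ (ltnW mL))) ?(leq_trans L1)//.
    by rewrite ler_wpM2l ?mulr_ge0// nbvs_le// Lm ltnW.
  rewrite sumr_const_nat mul2n -addnn addnK -[leLHS]mulr_natr.
  rewrite ler_wpM2r// ler_wpM2r// ler_wpM2r//.
  by rewrite ler_nat.
apply: le_trans (norm_trig_sum _ _ _ _) _; first by rewrite leq_pmull.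
have var m : (L <= m < 2 * L)%N ->
    `|b m - b m.+1| <= 2 * (L%:R / n%:R) * `|a m - a m.+1| + n%:R^-1 * E.
  move=> /andP[Lm mL].
  have -> : b m - b m.+1 = (-1) ^+ c *
     ((2 * sin (m%:R * (t / 2))) * (a m - a m.+1) +
      2 * a m.+1 * (sin (m%:R * (t / 2)) - sin (m.+1%:R * (t / 2)))).
    by rewrite /b; ring.
  rewrite normrM normr_sign mul1r (le_trans (ler_normD _ _))// lerD//.
    rewrite normrM ler_wpM2r// (le_trans (sinm m))// mulrA ler_pM2r ?invr_gt0//.
    by rewrite -natrM ler_nat ltnW.
  rewrite !normrM ger0_norm// ger0_norm ?a0//.
  have am : a m.+1 <= E by rewrite nbvs_le// leqW//.
  have am0 : 0 <= a m.+1 by rewrite a0.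
  have : `|sin (m%:R * (t / 2)) - sin (m.+1%:R * (t / 2))| <= 2^-1 * n%:R^-1.
    rewrite (le_trans (norm_sinB _ _))//.
    have -> : m%:R * (t / 2) - m.+1%:R * (t / 2) = - (2^-1 * t).
      by rewrite -natr1; field.
    by rewrite normrN normrM ger0_norm// ler_wpM2l.
  set S := `|_ - _|; have : 0 <= S by rewrite normr_ge0.
  by set N := n%:R^-1; nra.
rewrite /tvar.
apply: (@le_trans _ _ (2 * (L%:R / n%:R) * tvar a L (2 * L) + L%:R / n%:R * E)).
  rewrite /tvar [`|a L|]ger0_norm ?a0// [`|a (2 * L)%N|]ger0_norm ?a0 ?muln_gt0//.
  rewrite mulrDr mulrDr -[leRHS]addrA; apply: lerD.
    by apply: lerD; apply: bm; rewrite ?leq_pmull ?muln_gt0.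
  have -> : L%:R / n%:R * E = \sum_(L <= m < 2 * L) n%:R^-1 * E.
    by rewrite sumr_const_nat mul2n -addnn addnK -[RHS]mulr_natl mulrA.
  rewrite mulr_sumr -big_split/= [leLHS]big_nat [leRHS]big_nat.
  exact: ler_sum.
have := nbvs_tvar L1; rewrite -/E; set r := L%:R / n%:R in rn0 *.
by set tv := tvar _ _ _ => ?; nra.
Qed.

Lemma norm_block_diff c n L x t : (1 <= L)%N -> (1 <= n)%N -> `|t| <= n%:R^-1 ->
  `|\sum_(L <= m < 2 * L) a m * (trig c (m%:R * (x + t)) - trig c (m%:R * x))|
  <= 3 * (1 + K) * (lam R n L * (a L + a (2 * L)%N)) *
     (peak L x + peak L (x + t / 2) + peak L (x + t)).
Proof.
move=> L1 n1 tn.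
have n0 : 0 < n%:R :> R by rewrite ltr0n.
have E0 : 0 <= a L + a (2 * L)%N by rewrite addr_ge0 ?a0 ?muln_gt0.
have K10 : 0 <= 1 + K by rewrite addr_ge0.
have [[p0 p1] p2] := (peak_ge0 L x, peak_ge0 L (x + t / 2), peak_ge0 L (x + t)).
have [Ln|nL] := leqP L n.
  rewrite /lam min_l; last by rewrite ler_pdivrMr// mul1r ler_nat.
  rewrite (le_trans (norm_block_diff_low _ _ _ Ln tn))// !mulrA.
  rewrite ler_wpM2l ?mulr_ge0 ?divr_ge0 ?invr_ge0 ?ler0n//; lra.
rewrite /lam min_r; last by rewrite ler_pdivlMr// mul1r ler_nat ltnW.
have -> : \sum_(L <= m < 2 * L) a m * (trig c (m%:R * (x + t)) - trig c (m%:R * x))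
   = \sum_(L <= m < 2 * L) a m * trig c (m%:R * (x + t)) -
     \sum_(L <= m < 2 * L) a m * trig c (m%:R * x).
  by rewrite -sumrB; apply: eq_bigr => m _; rewrite mulrBr.
rewrite (le_trans (ler_normB _ _))//.
have := norm_block_le c (x + t) L1; have := norm_block_le c x L1.
have : 0 <= (1 + K) * (a L + a (2 * L)%N) by rewrite mulr_ge0.
rewrite mul1r -[3 * _ * _]mulrA.
by set E := _ * _; move=> ? ? ?; nra.
Qed.

End dyadic_block.

(** * Schur's test and a dyadic Hardy inequality *)

(** The power function lies above its tangents. *)
Lemma powR_tangent (R : realType) (p x y : R) : 1 < p -> 0 <= x -> 0 <= y ->
  y `^ p + p * y `^ (p - 1) * (x - y) <= x `^ p.
Proof.
move=> p1 x0 y0.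
have p0 : 0 < p by lra.
have pp : p - 1 != 0 by rewrite subr_eq0 gt_eqF.
have := @conjugate_powR R x (y `^ (p - 1)) p (p / (p - 1)) x0 (powR_ge0 _ _) p0.
have q0 : 0 < p / (p - 1) by rewrite divr_gt0// subr_gt0.
have pq : (p - 1) * (p / (p - 1)) = p by rewrite mulrCA divff// mulr1.
move=> /(_ q0); rewrite invf_div -powRrM pq.
have -> : p^-1 + (p - 1) / p = 1 by field; rewrite gt_eqF.
move=> /(_ erefl) H.
have {H} : p * (x * y `^ (p - 1)) <= x `^ p + (p - 1) * y `^ p.
  have -> : x `^ p + (p - 1) * y `^ p =
      p * (x `^ p / p + y `^ p * ((p - 1) / p)).
    by field; rewrite gt_eqF.
  by rewrite ler_pM2l.
have := mulr_powRB1 y0 p0; set z := y `^ (p - 1) => <-; nra.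
Qed.

(** Jensen's inequality for [powR], with weights of total mass at most [S]. *)
Lemma powR_wsum_le (R : realType) (p S : R) (I : Type) (r : seq I) (k w : I -> R) :
  1 < p -> 0 < S -> (forall i, 0 <= k i) -> (forall i, 0 <= w i) ->
  \sum_(i <- r) k i <= S ->
  (\sum_(i <- r) k i * w i) `^ p <= S `^ p * S^-1 * \sum_(i <- r) k i * w i `^ p.
Proof.
move=> p1 S0 k0 w0 kS.
(* Sum the tangent inequality at the mean [y = X / S]. *)
set X := \sum_(i <- r) k i * w i.
have X0 : 0 <= X by apply: sumr_ge0 => i _; rewrite mulr_ge0.
pose y := X / S.
have y0 : 0 <= y by rewrite divr_ge0// ltW.
have XS : X = S * y by rewrite /y mulrCA divff ?mulr1// gt_eqF.
have Hsum : S * y `^ p <= \sum_(i <- r) k i * w i `^ p.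
  apply: (@le_trans _ _ (\sum_(i <- r) k i * (y `^ p + p * y `^ (p - 1) * (w i - y)))).
    have -> : \sum_(i <- r) k i * (y `^ p + p * y `^ (p - 1) * (w i - y)) =
      (\sum_(i <- r) k i) * (y `^ p - p * y `^ (p - 1) * y) + p * y `^ (p - 1) * X.
      rewrite /X mulr_sumr mulr_suml -big_split/=; apply: eq_bigr => i _; ring.
    have p0 : 0 < p by lra.
    rewrite XS -(mulr_powRB1 y0 p0).
    have := powR_ge0 y (p - 1); set z := y `^ (p - 1); set K := \sum_(i <- r) k i in kS *.
    have : 0 <= (S - K) * (p - 1) by rewrite mulr_ge0 ?subr_ge0// ltW.
    move=> H z0; have := mulr_ge0 H (mulr_ge0 y0 z0).
    nra.
  by apply: ler_sum => i _; rewrite ler_wpM2l// powR_tangent.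
rewrite XS powRM ?(ltW S0)// -mulrA ler_wpM2l ?powR_ge0//.
by rewrite mulrC ler_pdivlMr// mulrC.
Qed.

(** The Toeplitz kernel [th ^ |i - j|]; with truncated subtraction
    [(i - j) + (j - i)] is [|i - j|]. *)
Definition toep (R : realType) (th : R) (i j : nat) : R := th ^+ ((i - j) + (j - i)).

Lemma toepC (R : realType) (th : R) i j : toep th i j = toep th j i.
Proof. by rewrite /toep addnC. Qed.

Lemma geom_sum_le (R : realType) (th : R) M : 0 <= th < 1 ->
  \sum_(i < M) th ^+ i <= (1 - th)^-1.
Proof.
move=> /andP[t0 t1]; rewrite -[leRHS]mul1r ler_pdivlMr ?subr_gt0//.
have -> : (\sum_(i < M) th ^+ i) * (1 - th) = 1 - th ^+ M.
  rewrite -[X in X - th ^+ M](expr1n _ M) subrXX mulrC; congr (_ * _).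
  by apply: eq_bigr => i _; rewrite expr1n mul1r.
by rewrite gerBl exprn_ge0.
Qed.

Lemma toep_sum_le (R : realType) (th : R) M j : 0 <= th < 1 ->
  \sum_(i < M) toep th i j <= 2 / (1 - th).
Proof.
move=> th01; have /andP[t0 t1] := th01.
have aux : \sum_(i < M) toep th i j <= (1 - th)^-1 + \sum_(k < j) th ^+ k.+1.
  elim: j M => [|j IH] M.
    rewrite big_ord0 addr0; under eq_bigr do rewrite /toep subn0 sub0n addn0.
    exact: geom_sum_le.
  case: M => [|M].
    rewrite big_ord0 addr_ge0 ?invr_ge0 ?subr_ge0 ?(ltW t1)//.
    by rewrite sumr_ge0// => i _; rewrite exprn_ge0.
  rewrite big_ord_recl/= /toep sub0n subn0 add0n addrC big_ord_recr/= addrA lerD2r.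
  by apply: le_trans (IH M); apply: ler_sum => i _; rewrite /toep /bump/= !subSS.
apply: (le_trans aux).
have : \sum_(k < j) th ^+ k.+1 <= (1 - th)^-1.
  apply: le_trans (geom_sum_le j th01); apply: ler_sum => i _.
  by rewrite exprS ler_piMl ?exprn_ge0// ltW.
lra.
Qed.

(** Schur's test for the Toeplitz kernel [th ^ |i - j|] on [l^p]. *)
Lemma schur_toep (R : realType) (p th : R) (w : nat -> R) M1 M2 :
  1 < p -> 0 <= th < 1 -> (forall i, 0 <= w i) ->
  \sum_(j < M1) (\sum_(i < M2) toep th i j * w i) `^ p <=
  (2 / (1 - th)) `^ p * \sum_(i < M2) w i `^ p.
Proof.
move=> p1 th01 w0; have /andP[t0 t1] := th01.
set S := 2 / (1 - th).
have S0 : 0 < S by rewrite divr_gt0// subr_gt0.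
have k0 i j : 0 <= toep th i j by rewrite exprn_ge0.
apply: (@le_trans _ _ (\sum_(j < M1) S `^ p * S^-1 *
    \sum_(i < M2) toep th i j * w i `^ p)).
  apply: ler_sum => j _; apply: powR_wsum_le => //.
  exact: toep_sum_le.
rewrite -mulr_sumr exchange_big/= -mulrA ler_wpM2l ?powR_ge0//.
rewrite mulrC ler_pdivrMr// mulr_suml; apply: ler_sum => i _.
rewrite -mulr_suml mulrC ler_wpM2l ?powR_ge0//.
by under eq_bigr do rewrite toepC; exact: toep_sum_le.
Qed.

Lemma powRX (R : realType) (p x : R) (i : nat) : 0 <= x ->
  (x ^+ i) `^ p = (x `^ p) ^+ i.
Proof.
by move=> x0; elim: i => [|i IH]; rewrite ?powR1// !exprS powRM ?exprn_ge0// IH.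
Qed.

(** For [i <= j] the scaled kernel decays like [al ^ (j - i)], for [i >= j] like
    [be ^ (i - j)]. *)
Lemma toep_scale_le (R : realType) (al be th W : R) (i j : nat) :
  0 < al -> 0 < be -> be * (2 * al) = 1 -> al <= th -> be <= th -> 0 <= W ->
  al ^+ j * (W * 2 ^+ minn i j) <= toep th i j * (W * (2 * al) ^+ i).
Proof.
move=> al0 be0 bea alth beth W0; rewrite /toep.
have th0 : 0 <= th := le_trans (ltW al0) alth.
have [ij|/ltnW ji] := leqP i j.
  have -> : (i - j = 0)%N by apply/eqP; rewrite subn_eq0.
  rewrite add0n exprMn.
  have -> : al ^+ j * (W * 2 ^+ i) = al ^+ (j - i) * (W * (2 ^+ i * al ^+ i)).
    by rewrite -{1}(subnK ij) exprD; ring.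
  rewrite ler_wpM2r ?lerXn2r ?nnegrE ?(ltW al0)//.
  by rewrite !mulr_ge0 ?exprn_ge0 ?(ltW al0).
have -> : (j - i = 0)%N by apply/eqP; rewrite subn_eq0.
rewrite addn0.
have -> : al ^+ j * (W * 2 ^+ j) = be ^+ (i - j) * (W * (2 * al) ^+ i).
  transitivity ((be * (2 * al)) ^+ (i - j) * (al ^+ j * (W * 2 ^+ j))).
    by rewrite bea expr1n mul1r.
  rewrite exprMn -[in RHS](subnK ji) addnK exprD [(2 * al) ^+ j]exprMn; ring.
rewrite ler_wpM2r ?lerXn2r ?nnegrE ?(ltW be0)//.
by rewrite mulr_ge0 ?exprn_ge0 ?mulr_ge0 ?(ltW al0).
Qed.

(** Both Hardy inequalities at once, in dyadic form: [2 ^ minn i j] is the size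
    of the [i]-th block at distance [2 ^ -j] from the singularity. *)
Lemma dyadic_hardy (R : realType) (p : R) : 1 < p ->
  exists2 C : R, 0 <= C & forall (W : nat -> R) M1 M2, (forall i, 0 <= W i) ->
  \sum_(j < M1) (2 ^+ j)^-1 * (\sum_(i < M2) W i * 2 ^+ minn i j) `^ p <=
  C * \sum_(i < M2) W i `^ p * (2 ^+ i) `^ (p - 1).
Proof.
move=> p1; have p0 : 0 < p by lra.
(* [al ^ p = 1 / 2] absorbs the weight [2 ^ -j], and [al * be = 1 / 2]; both are
   less than 1 because [1 < p]. *)
pose al : R := 2 `^ (- p^-1); pose be : R := 2 `^ (p^-1 - 1).
have al0 : 0 < al by rewrite powR_gt0.
have be0 : 0 < be by rewrite powR_gt0.
have albe : al * be = 2^-1.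
  rewrite /al /be -powRD; last by rewrite pnatr_eq0 implybT.
  by rewrite addrA addNr add0r powR_inv1.
have alp : al `^ p = 2^-1.
  by rewrite -powRrM mulNr mulVf ?gt_eqF// powR_inv1.
have lt1 (e : R) : e < 0 -> 2 `^ e < 1.
  by move=> e0; rewrite /powR pnatr_eq0 expR_lt1 pmulr_llt0// ln_gt0// ltr1n.
have al1 : al < 1 by apply: lt1; rewrite oppr_lt0 invr_gt0.
have be1 : be < 1 by apply: lt1; rewrite subr_lt0 invf_lt1.
pose th := Num.max al be.
have th01 : 0 <= th < 1.
  by rewrite /th; case: (leP al be) => _; apply/andP; split => //; exact: ltW.
have [alth beth] : al <= th /\ be <= th by rewrite /th !le_max !lexx orbT.
exists ((2 / (1 - th)) `^ p); first exact: powR_ge0.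
move=> W M1 M2 W0.
pose w i := W i * (2 * al) ^+ i.
have w0 i : 0 <= w i by rewrite mulr_ge0// exprn_ge0// mulr_ge0// ltW.
have wp i : w i `^ p = W i `^ p * (2 ^+ i) `^ (p - 1).
  rewrite /w powRM//; last by rewrite exprn_ge0// mulr_ge0// ltW.
  congr (_ * _).
  rewrite exprMn powRM ?exprn_ge0 ?(ltW al0)//.
  rewrite (powRX p i (ltW al0)) alp exprVn.
  by rewrite -(@mulr_powRB1 _ (2 ^+ i) p)// ?exprn_ge0// mulrAC divff ?mul1r.
under [X in _ <= _ * X]eq_bigr do rewrite -wp.
apply: le_trans (schur_toep M1 M2 p1 th01 w0); apply: ler_sum => j _.
have -> : (2 ^+ j)^-1 = (al ^+ j) `^ p by rewrite powRX ?(ltW al0)// alp exprVn.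
have s0 : 0 <= \sum_(i < M2) W i * 2 ^+ minn i j.
  by apply: sumr_ge0 => i _; rewrite mulr_ge0// exprn_ge0.
rewrite -powRM ?exprn_ge0 ?(ltW al0)//.
apply: ge0_ler_powR; rewrite ?nnegrE ?(ltW p0)//.
- by rewrite mulr_ge0 ?exprn_ge0 ?(ltW al0).
- by apply: sumr_ge0 => i _; rewrite mulr_ge0// exprn_ge0//; case/andP: th01.
rewrite mulr_sumr; apply: ler_sum => i _.
apply: (toep_scale_le (be := be)) => //; lra.
Qed.

(** * Condensation: from dyadic indices back to all indices *)

Lemma lam_ge0 (R : realType) n L : 0 <= lam R n L.
Proof. by rewrite /lam le_min ler01 divr_ge0. Qed.

Lemma lam_mono (R : realType) n L L' : (L <= L')%N -> lam R n L <= lam R n L'.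
Proof.
move=> LL; rewrite /lam le_min !ge_min lexx orbT andbT.
by rewrite ler_wpM2r ?invr_ge0// ler_nat.
Qed.

Lemma lam_double (R : realType) n L k : (L <= 2 * k)%N ->
  lam R n L <= 2 * lam R n k.
Proof.
move=> Lk; rewrite /lam minr_pMr// mulr1 le_min !ge_min.
have -> : L%:R / n%:R <= 2 * (k%:R / n%:R) :> R.
  by rewrite mulrA -natrM ler_wpM2r ?invr_ge0// ler_nat.
by rewrite (ler_nat R 1 2) orbT.
Qed.

Lemma powR_add_le (R : realType) (p x y : R) : 0 <= p -> 0 <= x -> 0 <= y ->
  (x + y) `^ p <= 2 `^ p * (x `^ p + y `^ p).
Proof.
move=> p0; wlog xy : x y / x <= y => [H x0 y0|x0 y0].
  by have [/H->//|/ltW/H] := leP x y; rewrite addrC [X in _ * X]addrC => ->.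
apply: (@le_trans _ _ ((2 * y) `^ p)).
  by apply: ge0_ler_powR; rewrite ?nnegrE ?addr_ge0 ?mulr_ge0//; lra.
by rewrite powRM// ler_wpM2l ?powR_ge0// lerDr powR_ge0.
Qed.

Lemma powR_comparable (R : realType) (e x y : R) : 0 < x -> 0 < y ->
  x <= 2 * y -> y <= 2 * x -> x `^ e <= 2 `^ `|e| * y `^ e.
Proof.
have pos (f u v : R) : 0 <= f -> 0 < u -> 0 < v -> u <= 2 * v ->
    u `^ f <= 2 `^ f * v `^ f.
  move=> f0 u0 v0 uv; rewrite -powRM// ?(ltW v0)//.
  by apply: ge0_ler_powR; rewrite ?nnegrE ?mulr_ge0 ?(ltW u0) ?(ltW v0).
move=> x0 y0 xy yx; have [e0|/ltW e0] := leP 0 e.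
  by rewrite ger0_norm// pos.
have [f ef] : exists f, e = - f by exists (- e); rewrite opprK.
have f0 : 0 <= f by rewrite -oppr_le0 -ef.
rewrite ef normrN ger0_norm// !powRN ler_pdivlMr ?powR_gt0// mulrC.
by rewrite ler_pdivrMr ?powR_gt0// pos.
Qed.

(** The weighted [p]-th powers whose sum is, up to a constant, the [p]-th power
    of the right-hand side of the theorem. *)
Definition wterm (R : realType) (p : R) (a : nat -> R) (n k : nat) : R :=
  k%:R `^ (p - 2) * (lam R n k * a k) `^ p.

Lemma sum_double_le (R : realType) (q : nat -> R) N : (forall k, 0 <= q k) ->
  \sum_(1 <= k < N) q (2 * k)%N <= \sum_(1 <= k < 2 * N) q k.
Proof.
move=> q0; elim: N => [|[|N] IH]; first by rewrite !big_geq.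
  by rewrite big_geq// sumr_ge0.
have -> : (2 * N.+2 = (2 * N.+1).+2)%N by rewrite mulnS.
rewrite [leLHS]big_nat_recr//=.
rewrite [leRHS]big_nat_recr ?muln_gt0//= [in leRHS]big_nat_recr ?muln_gt0//=.
by rewrite -addrA lerD// lerDl.
Qed.

Section condensation.
Variables (R : realType) (p K : R).
Hypothesis p1 : 1 < p.
Hypothesis K0 : 0 <= K.

Let cst1 : R := 2 `^ `|p - 2| * (2 `^ p * (2 * (1 + K)) `^ p).

Let cst1_ge0 : 0 <= cst1.
Proof. by rewrite !mulr_ge0 ?powR_ge0. Qed.

Variables (a : nat -> R).
Hypothesis a0 : forall m, (1 <= m)%N -> 0 <= a m.
Hypothesis aK : forall n, (1 <= n)%N ->
  \sum_(n <= m < (2 * n).+1) `|a m - a m.+1| <= K * (a n + a (2 * n)%N).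
Variable n : nat.

Lemma wterm_ge0 k : 0 <= wterm p a n k.
Proof. by rewrite mulr_ge0 ?powR_ge0. Qed.

(* One dyadic index against one index [k] of the preceding block. *)
Let pt H k : (1 <= H)%N -> (H <= k < 2 * H)%N ->
  (lam R n (2 * H) * a (2 * H)%N) `^ p * (2 * H)%:R `^ (p - 2) <=
  cst1 * (wterm p a n k + wterm p a n (2 * k)).
Proof.
move=> H1 /andP[Hk kH].
have k1 : (1 <= k)%N := leq_trans H1 Hk.
have p0 : 0 <= p := ltW (lt_trans ltr01 p1).
have K10 : 0 <= 1 + K by rewrite addr_ge0.
set L := (2 * H)%N.
have L0 : 0 < L%:R :> R by rewrite ltr0n muln_gt0.
have aL : a L <= (1 + K) * (a k + a (2 * k)%N).
  by apply: (nbvs_le a0 aK) => //; rewrite (ltnW kH) leq_mul2l.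
pose u m := lam R n m * a m.
have u0 m : (1 <= m)%N -> 0 <= u m by move=> m1; rewrite mulr_ge0 ?lam_ge0// a0.
have k20 : (1 <= 2 * k)%N by rewrite muln_gt0.
have uL : u L <= 2 * (1 + K) * (u k + u (2 * k)%N).
  have l1 : lam R n L <= 2 * lam R n k by rewrite lam_double// leq_mul2l.
  have l2 : lam R n k <= lam R n (2 * k) by rewrite lam_mono// leq_pmull.
  have := a0 k1; have := a0 k20; have := lam_ge0 R n L; have := lam_ge0 R n k.
  rewrite /u => h1 h2 h3 h4.
  apply: (@le_trans _ _ (2 * lam R n k * ((1 + K) * (a k + a (2 * k)%N)))).
    by apply: ler_pM => //; rewrite a0// muln_gt0.
  rewrite [leLHS](_ : _ = 2 * (1 + K) * (lam R n k * a k + lam R n k * a (2 * k)%N));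
    last by ring.
  rewrite ler_wpM2l ?mulr_ge0// lerD2l ler_wpM2r//.
have uLp : u L `^ p <= 2 `^ p * (2 * (1 + K)) `^ p * (u k `^ p + u (2 * k)%N `^ p).
  rewrite mulrAC; apply: le_trans
    (ler_wpM2r (powR_ge0 _ _) (powR_add_le p0 (u0 _ k1) (u0 _ k20))).
  rewrite -powRM ?addr_ge0 ?u0 ?mulr_ge0//.
  rewrite mulrC; apply: ge0_ler_powR; rewrite ?nnegrE ?u0 ?muln_gt0//.
  by rewrite !mulr_ge0 ?addr_ge0 ?u0.
have c1 m : (0 < m)%N -> (L <= 2 * m)%N -> (m <= 2 * L)%N ->
    L%:R `^ (p - 2) <= 2 `^ `|p - 2| * m%:R `^ (p - 2).
  by move=> m0 Lm mL; apply: powR_comparable; rewrite ?L0 ?ltr0n// -natrM ler_nat.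
rewrite -/(u L).
apply: (le_trans (ler_wpM2r (powR_ge0 _ _) uLp)).
rewrite /cst1 /wterm -/(u k) -/(u (2 * k)%N).
set P := 2 `^ p * _.
have P0 : 0 <= P by rewrite mulr_ge0 ?powR_ge0.
have h1 : L%:R `^ (p - 2) <= 2 `^ `|p - 2| * k%:R `^ (p - 2).
  by apply: c1 => //; rewrite ?leq_mul2l// (leq_trans (ltnW kH))// leq_pmull.
have h2 : L%:R `^ (p - 2) <= 2 `^ `|p - 2| * (2 * k)%:R `^ (p - 2).
  apply: c1 => //; rewrite leq_mul2l/= ?(ltnW kH)//.
  by rewrite (leq_trans Hk) ?leq_pmull.
have := ler_wpM2l (mulr_ge0 P0 (powR_ge0 (u k) p)) h1.
have := ler_wpM2l (mulr_ge0 P0 (powR_ge0 (u (2 * k)%N) p)) h2.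
move: (L%:R `^ _) (k%:R `^ _) ((2 * k)%:R `^ _) (u k `^ p) (u _ `^ p) => x y z v w.
lra.
Qed.

(* Averaging over the [H] values of [k]; the length of the block accounts for the
   change of exponent from [p - 2] to [p - 1]. *)
Let block H : (1 <= H)%N ->
  (lam R n (2 * H) * a (2 * H)%N) `^ p * (2 * H)%:R `^ (p - 1) <=
  2 * cst1 * \sum_(H <= k < 2 * H) (wterm p a n k + wterm p a n (2 * k)).
Proof.
move=> H1.
have L0 : (2 * H)%:R != 0 :> R by rewrite pnatr_eq0 muln_eq0/= -lt0n.
have -> : (2 * H)%:R `^ (p - 1) = (2 * H)%:R * (2 * H)%:R `^ (p - 2) :> R.
  rewrite -[X in _ = X * _](@powRr1 R)// -powRD ?L0 ?implybT//.
  by congr (_ `^ _); ring.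
rewrite natrM -natrM.
set X := lam R n _ * _; set Y := (2 * H)%:R `^ _.
have -> : X `^ p * ((2 * H)%:R * Y) = 2 * \sum_(H <= k < 2 * H) X `^ p * Y.
  by rewrite sumr_const_nat mul2n -addnn addnK natrD; ring.
rewrite -mulrA ler_wpM2l// mulr_sumr [leLHS]big_nat [leRHS]big_nat.
by apply: ler_sum => k Hk; exact: pt.
Qed.

Let wt_sum_ge0 (r : seq nat) : 0 <= \sum_(k <- r) wterm p a n k.
Proof. by apply: sumr_ge0 => k _; exact: wterm_ge0. Qed.

Let dyadic_sum M :
  \sum_(i < M) (lam R n (2 ^ i) * a (2 ^ i)%N) `^ p * (2 ^ i)%:R `^ (p - 1) <=
  (1 + 4 * cst1) * \sum_(1 <= k < 2 ^ M) wterm p a n k.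
Proof.
case: M => [|M].
  by rewrite big_ord0 big_geq// mulr0.
have aux : \sum_(i < M)
   (lam R n (2 ^ i.+1) * a (2 ^ i.+1)%N) `^ p * (2 ^ i.+1)%:R `^ (p - 1) <=
   2 * cst1 * \sum_(1 <= k < 2 ^ M) (wterm p a n k + wterm p a n (2 * k)).
  elim: M => [|M IH]; first by rewrite big_ord0 big_geq// mulr0.
  rewrite big_ord_recr/= [in leRHS](big_cat_nat (n := 2 ^ M))/=.
  - rewrite mulrDr lerD// expnS; apply: block; by rewrite expn_gt0.
  - by rewrite expn_gt0.
  - by rewrite leq_exp2l.
rewrite big_ord_recl/= expn0 powR1 mulr1 mulrDl mul1r lerD//.
  rewrite big_ltn; last by rewrite expnS (@leq_trans (2 * 1))// leq_mul2l expn_gt0.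
  by rewrite {1}/wterm powR1 mul1r lerDl wt_sum_ge0.
apply: (le_trans aux).
have -> : 4 * cst1 = 2 * cst1 * 2 by ring.
rewrite -[leRHS]mulrA ler_wpM2l ?(mulr_ge0 (ler0n R 2) cst1_ge0)//.
rewrite big_split/= [leRHS]mulr_natl mulr2n lerD//.
  rewrite [leRHS](big_cat_nat (n := 2 ^ M)) ?expn_gt0//=.
    by rewrite lerDl wt_sum_ge0.
  by rewrite leq_exp2l.
by rewrite expnS sum_double_le// => k; exact: wterm_ge0.
Qed.

Lemma nbvs_dyadic_sum M :
  \sum_(i < M) (lam R n (2 ^ i) * (a (2 ^ i)%N + a (2 * 2 ^ i)%N)) `^ p *
     (2 ^ i)%:R `^ (p - 1) <=
  2 `^ p * (2 * (1 + 4 * cst1)) * \sum_(1 <= k < 2 ^ M.+1) wterm p a n k.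
Proof.
have p0 : 0 <= p := ltW (lt_trans ltr01 p1).
pose D i := (lam R n (2 ^ i) * a (2 ^ i)%N) `^ p * (2 ^ i)%:R `^ (p - 1).
have D0 i : 0 <= D i by rewrite mulr_ge0 ?powR_ge0.
have e0 i : (0 < 2 ^ i)%N by rewrite expn_gt0.
apply: (@le_trans _ _ (2 `^ p * (\sum_(i < M) D i + \sum_(i < M) D i.+1))).
  rewrite -big_split mulr_sumr; apply: ler_sum => i _ /=.
  have l1 : lam R n (2 ^ i) <= lam R n (2 ^ i.+1) by rewrite lam_mono// leq_exp2l.
  set u := lam R n (2 ^ i) * a (2 ^ i)%N; set v := lam R n (2 ^ i.+1) * a (2 ^ i.+1)%N.
  have u0 : 0 <= u by rewrite mulr_ge0 ?lam_ge0 ?a0.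
  have v0 : 0 <= v by rewrite mulr_ge0 ?lam_ge0 ?a0.
  apply: (@le_trans _ _ ((u + v) `^ p * (2 ^ i)%:R `^ (p - 1))).
    rewrite ler_wpM2r ?powR_ge0//; apply: ge0_ler_powR; rewrite ?nnegrE ?addr_ge0//.
      by rewrite mulr_ge0 ?lam_ge0// addr_ge0 ?a0 ?muln_gt0 ?e0.
    by rewrite mulrDr lerD2l -expnS ler_wpM2r// a0.
  apply: (le_trans (ler_wpM2r (powR_ge0 _ _) (powR_add_le p0 u0 v0))).
  rewrite -mulrA ler_wpM2l ?powR_ge0// mulrDl lerD2l ler_wpM2l ?powR_ge0//.
  by apply: ge0_ler_powR; rewrite ?nnegrE ?subr_ge0 ?(ltW p1)// ler_nat leq_exp2l.
rewrite -mulrA ler_wpM2l ?powR_ge0// -mulrA [leRHS]mulr_natl mulr2n lerD//.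
  apply: (le_trans (dyadic_sum M)); rewrite ler_wpM2l
    ?(addr_ge0 ler01 (mulr_ge0 (ler0n R 4) cst1_ge0))//.
  rewrite [leRHS](big_cat_nat (n := 2 ^ M)) ?expn_gt0//=.
    by rewrite lerDl wt_sum_ge0.
  by rewrite leq_exp2l.
by apply: le_trans (dyadic_sum M.+1); rewrite big_ord_recl/= lerDr D0.
Qed.
End condensation.

Lemma nbvs_dyadic_sum_le (R : realType) (p K : R) : 1 < p -> 0 <= K ->
  exists2 C : R, 0 <= C & forall (a : nat -> R) n M,
  (forall m, (1 <= m)%N -> 0 <= a m) ->
  (forall n, (1 <= n)%N ->
    \sum_(n <= m < (2 * n).+1) `|a m - a m.+1| <= K * (a n + a (2 * n)%N)) ->
  \sum_(i < M) (lam R n (2 ^ i) * (a (2 ^ i)%N + a (2 * 2 ^ i)%N)) `^ p *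
     (2 ^ i)%:R `^ (p - 1) <=
  C * \sum_(1 <= k < 2 ^ M.+1) wterm p a n k.
Proof.
move=> p1 K0; eexists; last first.
  by move=> a n M a0 aK; exact: (nbvs_dyadic_sum p1 K0 a0 aK).
by rewrite !(mulr_ge0, addr_ge0) ?powR_ge0.
Qed.

(** * Sublevel sets of [|sin (y / 2)|] *)

Lemma norm_sin_ge (R : realType) (v : R) : `|v| <= pi / 2 -> `|v| / 4 <= `|sin v|.
Proof.
move=> vpi; have := @ler_quarter_sin R `|v|; rewrite normr_ge0 vpi => /(_ isT).
move=> /le_trans; apply.
have [v0|v0] := leP 0 v; first by rewrite (ger0_norm v0) ler_norm.
by rewrite (ltr0_norm v0) sinN -[leRHS]normrN ler_norm.
Qed.

(** On a window slightly larger than a period, [|sin (y / 2)|] is small only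
    near [0] and near [2 * pi]. *)
Lemma sin_half_small (R : realType) (y e : R) : -1 <= y <= 2 * pi + 1 ->
  `|sin (y / 2)| <= e -> `|y| <= 8 * e \/ `|y - 2 * pi| <= 8 * e.
Proof.
move=> /andP[y1 y2] ye; have pi1 := @pihalf_ge1 R.
have [ypi|piy] := leP y pi; [left|right].
  have : `|y / 2| <= pi / 2 by rewrite ler_norml; apply/andP; split; lra.
  by move=> /norm_sin_ge; rewrite normrM [`|2^-1|]ger0_norm//; lra.
have : `|y / 2 - pi| <= pi / 2 by rewrite ler_norml; apply/andP; split; lra.
move=> /norm_sin_ge; rewrite sinB sinpi cospi mulr0 subr0 mulrN1 normrN.
have -> : y - 2 * pi = (y / 2 - pi) * 2 by field.
by rewrite normrM [`|2|]ger0_norm//; lra.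
Qed.

(** The points whose translate by [s] lies in the sublevel set of
    [|sin (y / 2)|] at height [e]. *)
Definition sin_sublevel (R : realType) (s e : R) : set R :=
  [set x | `|sin ((x + s) / 2)| <= e].

Lemma measurable_sin_sublevel (R : realType) (s e : R) :
  measurable (sin_sublevel s e).
Proof.
have cf : continuous (fun x : R => `|sin ((x + s) / 2)|).
  move=> x; apply: (@continuous_comp _ _ _ 
    (fun x : R => sin ((x + s) / 2)) (@Num.norm _ R)).
    apply: (@continuous_comp _ _ _ (fun x : R => (x + s) / 2) sin).
      by apply: cvgM; [apply: cvgD; [exact: cvg_id|exact: cvg_cst]|exact: cvg_cst].
    exact: continuous_sin.
  exact: norm_continuous.
have -> : sin_sublevel s e = [set: R] `&`
    (fun x : R => `|sin ((x + s) / 2)|) @^-1` `]-oo, e].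
  by rewrite setTI; apply/seteqP; split => x /=; rewrite in_itv.
by apply: (continuous_measurable_fun cf) => //.
Qed.

Lemma measure_sin_sublevel (R : realType) (s e : R) : `|s| <= 1 -> 0 < e ->
  (lebesgue_measure (sin_sublevel s e `&` `[0%R, (2 * pi)%R]) <= (32 * e)%:E)%E.
Proof.
move=> s1 e0.
pose I c : set R := `[c - 8 * e, c + 8 * e]%classic.
have mI c : lebesgue_measure (I c) = (16 * e)%:E.
  rewrite lebesgue_measure_itv/= lte_fin ifT; last by lra.
  by rewrite -EFinB; congr (_%:E); ring.
apply: (@le_trans _ _ (lebesgue_measure (I (- s) `|` I (2 * pi - s)))).
  apply: le_measure; rewrite ?inE.
  - by apply: measurableI => //; exact: measurable_sin_sublevel.
  - by apply: measurableU; exact: measurable_itv.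
  move=> x [/= xs]; rewrite in_itv/= => /andP[x0 x1].
  move: s1; rewrite ler_norml => /andP[s1 s2].
  have : -1 <= x + s <= 2 * pi + 1 by apply/andP; split; lra.
  by move=> /sin_half_small/(_ xs)[]; rewrite ler_norml => /andP[h1 h2];
    [left|right]; rewrite /I/= in_itv/=; apply/andP; split; lra.
have mIm c : measurable (I c) by exact: measurable_itv.
have mU (A B : set R) : measurable A -> measurable B ->
    (lebesgue_measure (A `|` B) <= lebesgue_measure A + lebesgue_measure B)%E.
  by move=> mA mB; exact: measureU2.
apply: (le_trans (mU _ _ (mIm _) (mIm _))).
by rewrite !mI -EFinD lee_fin; lra.
Qed.

(** Each [y] has a level [j <= M] such that all the peaks of index less than [M]
    are at most twice [2 ^ minn i j]; on the last level [j = M] this is the bound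
    by [2 ^ i]. *)
Lemma peak_dyadic (R : realType) (M : nat) (y : R) :
  exists2 j : 'I_M.+1, `|sin (y / 2)| <= (2 ^+ j)^-1 &
    forall i, (i < M)%N -> peak (2 ^ i) y <= 2 * 2 ^+ minn i j.
Proof.
set s := `|sin (y / 2)|.
have pk i : peak (2 ^ i) y <= 2 ^+ i.
  rewrite /peak -[leRHS]invrK lef_pV2 ?posrE ?lt_max ?invr_gt0 ?exprn_gt0//; last first.
    by rewrite natrX exprn_gt0.
  by rewrite le_max natrX lexx.
have exP : exists j, (j <= M)%N && (s <= (2 ^+ j)^-1).
  by exists 0%N; rewrite expr0 invr1 sin_max.
have ubP j : (j <= M)%N && (s <= (2 ^+ j)^-1) -> (j <= M)%N by case/andP.
case: (ex_maxnP exP ubP) => j /andP[jM sj] jmax.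
exists (inord j) => /=; rewrite inordK ?ltnS// => i iM.
have [ij|ji] := leqP i j.
  by rewrite (le_trans (pk i))// ler_peMl ?exprn_ge0// ler1n.
have {}jM : (j < M)%N := ltn_trans ji iM.
have sj' : (2 ^+ j.+1)^-1 < s.
  rewrite ltNge; apply/negP => h.
  by have := jmax j.+1; rewrite jM h ltnn => /(_ isT).
have p0 : 0 < (2 ^+ j.+1)^-1 :> R by rewrite invr_gt0 exprn_gt0.
rewrite -exprS /peak -[leRHS]invrK lef_pV2 ?posrE//.
by rewrite le_max (ltW sj') orbT.
Qed.

(** The [p]-th power of [sum_i W_i * peak] is dominated by a step function on the
    dyadic sublevel sets of [|sin (y / 2)|]. *)
Lemma peak_sum_powR_le (R : realType) (p : R) (W : nat -> R) M (s x : R) :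
  0 <= p -> (forall i, 0 <= W i) ->
  (\sum_(i < M) W i * peak (2 ^ i) (x + s)) `^ p <=
  2 `^ p * \sum_(j < M.+1) (\sum_(i < M) W i * 2 ^+ minn i j) `^ p *
     \1_(sin_sublevel s (2 ^+ j)^-1) x.
Proof.
move=> p0 W0.
have [j sj Hj] := peak_dyadic M (x + s).
have U0 (k : nat) : 0 <= \sum_(i < M) W i * 2 ^+ minn i k.
  by apply: sumr_ge0 => i _; rewrite mulr_ge0// exprn_ge0.
apply: (@le_trans _ _ ((2 * \sum_(i < M) W i * 2 ^+ minn i j) `^ p)).
  apply: ge0_ler_powR; rewrite ?nnegrE ?mulr_ge0//.
    by apply: sumr_ge0 => i _; rewrite mulr_ge0// peak_ge0.
  rewrite mulr_sumr; apply: ler_sum => i _.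
  by rewrite mulrCA ler_wpM2l// Hj.
rewrite powRM// ler_wpM2l ?powR_ge0// (bigD1 j)//=.
rewrite indicE mem_set// mulr1 lerDl sumr_ge0// => k _.
by rewrite mulr_ge0 ?powR_ge0// indicE.
Qed.

(** A measure is determined by its values on the intervals [`]a, b]]. *)
Lemma lebesgue_measure_translate (R : realType) (t : R) (A : set R) :
  measurable A -> lebesgue_measure ((fun x : R => x + t) @^-1` A) = lebesgue_measure A.
Proof.
move=> mA.
rewrite -[LHS]/(pushforward lebesgue_measure
  ((fun x : R => x + t) : _ -> measurableTypeR R) A).
apply/esym/lebesgue_measure_unique => //=.
  by apply: measurable_funD => //.
move=> _ _ [[a b]] _ <-; rewrite /pushforward.
have -> : (fun x : R => x + t) @^-1` `]a, b] = `](a - t), (b - t)]%classic.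
  apply/seteqP; split => x /=; rewrite !in_itv/= => /andP[? ?]; apply/andP; split; lra.
rewrite !lebesgue_measure_itv/= !lte_fin ltrD2r.
by case: ifP => // _; rewrite -!EFinB; congr (_%:E); ring.
Qed.

(** * Integrals over a period *)

Lemma integral_step_le (R : realType) (U : nat -> R) N (s : R) :
  `|s| <= 1 -> (forall j, 0 <= U j) ->
  (\int[lebesgue_measure]_(x in `[0%R, (2 * pi)%R])
     (\sum_(j < N) U j * \1_(sin_sublevel s (2 ^+ j)^-1) x)%:E <=
   (32 * \sum_(j < N) (2 ^+ j)^-1 * U j)%:E)%E.
Proof.
move=> s1 U0.
have mS j : measurable (sin_sublevel s ((2 ^+ j)^-1 : R)).
  exact: measurable_sin_sublevel.
have m1 j : measurable_fun (`[0%R, (2 * pi)%R] : set R)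
    (fun x => (\1_(sin_sublevel s (2 ^+ j)^-1) x)%:E : \bar R).
  by apply/measurable_EFinP; exact: measurable_indic.
under eq_integral do rewrite -sumEFin.
rewrite ge0_integral_sum//=; last 2 first.
- move=> j; apply/measurable_EFinP; apply: measurable_funM => //.
  by apply: measurable_indic; exact: mS.
- by move=> j x _; rewrite lee_fin mulr_ge0// indicE.
rewrite mulr_sumr -sumEFin; apply: lee_sum => j _.
under eq_integral do rewrite EFinM.
rewrite ge0_integralZl_EFin//; last exact: m1.
rewrite integral_indic//; last exact: mS.
have e0 : 0 < (2 ^+ j)^-1 :> R by rewrite invr_gt0 exprn_gt0.
have -> : 32 * ((2 ^+ j)^-1 * U j) = U j * (32 * (2 ^+ j)^-1) by ring.
by rewrite [leRHS]EFinM lee_wpmul2l ?lee_fin// measure_sin_sublevel.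
Qed.

(** The [L^p] norm over a period of a function dominated by three translates of
    [sum_i W_i * peak]. *)
Lemma integral_peak_sum_le (R : realType) (p : R) : 1 < p ->
  exists2 C : R, 0 <= C & forall (W : nat -> R) M (t : R) (g : R -> R),
  (forall i, 0 <= W i) -> `|t| <= 1 -> measurable_fun [set: R] g ->
  (forall x, `|g x| <= \sum_(i < M) W i *
     (peak (2 ^ i) x + peak (2 ^ i) (x + t / 2) + peak (2 ^ i) (x + t))) ->
  (\int[lebesgue_measure]_(x in `[0%R, (2 * pi)%R]) (`|g x| `^ p)%:E <=
   (C * \sum_(i < M) W i `^ p * (2 ^+ i) `^ (p - 1))%:E)%E.
Proof.
move=> p1; have p0 : 0 <= p by lra.
have [C C0 HC] := dyadic_hardy p1.
exists (2 `^ p * (2 `^ p * 2 `^ p) * 3 * 32 * C).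
  by rewrite !mulr_ge0 ?powR_ge0.
move=> W M t g W0 t1 mg gle.
pose U j := (\sum_(i < M) W i * 2 ^+ minn i j) `^ p.
have U0 j : 0 <= U j by exact: powR_ge0.
pose G (s x : R) : R := \sum_(j < M.+1) U j * \1_(sin_sublevel s (2 ^+ j)^-1) x.
have G0 (s x : R) : 0 <= G s x.
  by apply: sumr_ge0 => j _; rewrite mulr_ge0// indicE.
have mG (s : R) : measurable_fun (`[0%R, (2 * pi)%R] : set R) (G s).
  apply: measurable_sum => j; apply: measurable_funM => //.
  apply: measurable_indic; exact: measurable_sin_sublevel.
have mGE (s : R) : measurable_fun (`[0%R, (2 * pi)%R] : set R) (fun x => (G s x)%:E).
  by apply/measurable_EFinP; exact: mG.
have IG (s : R) : `|s| <= 1 -> (\int[lebesgue_measure]_(x in `[0%R, (2 * pi)%R])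
    (G s x)%:E <= (32 * C * \sum_(i < M) W i `^ p * (2 ^+ i) `^ (p - 1))%:E)%E.
  move=> s1; apply: (le_trans (integral_step_le _ s1 U0)).
  by rewrite lee_fin -mulrA ler_wpM2l// HC.
set cp := 2 `^ p.
have cp1 : 1 <= cp by rewrite -(powRr0 2) ler_powR// ler1n.
have cp0 : 0 <= cp by lra.
pose cc := cp * (cp * cp).
have cc0 : 0 <= cc by rewrite !mulr_ge0.
have ptw (x : R) : `|g x| `^ p <= cc * (G 0 x + G (t / 2) x + G t x).
  pose Psi (s : R) : R := \sum_(i < M) W i * peak (2 ^ i) (x + s).
  have Psi0 (s : R) : 0 <= Psi s by apply: sumr_ge0 => i _; rewrite mulr_ge0// peak_ge0.
  have gPsi : `|g x| <= Psi 0 + Psi (t / 2) + Psi t.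
    rewrite (le_trans (gle x))// /Psi -!big_split/=; apply: ler_sum => i _.
    by rewrite addr0 !mulrDr.
  have PG (s : R) : Psi s `^ p <= cp * G s x by exact: peak_sum_powR_le.
  have s0 := Psi0 0; have s1 := Psi0 (t / 2); have s2 := Psi0 t.
  apply: (@le_trans _ _ ((Psi 0 + Psi (t / 2) + Psi t) `^ p)).
    by apply: ge0_ler_powR; rewrite ?nnegrE ?addr_ge0.
  have h1 := powR_add_le p0 (addr_ge0 s0 s1) s2.
  have h2 := powR_add_le p0 s0 s1.
  apply: (le_trans h1); rewrite -/cp in h1 h2 *.
  rewrite /cc -mulrA ler_wpM2l//.
  have := PG 0; have := PG (t / 2); have := PG t.
  have := powR_ge0 (Psi t) p; have := G0 t x.
  move: h2; move: (_ `^ p) (_ `^ p) (_ `^ p) (_ `^ p) => q1 q2 q3 q4.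
  move: (G 0 x) (G _ x) (G _ x) => z0 z1 z2 h q3p z2p a1 a2 a3.
  have : 0 <= (cp - 1) * (cp * z2) by rewrite !mulr_ge0// subr_ge0.
  have := ler_wpM2l cp0 a2; have := ler_wpM2l cp0 a3.
  nra.
apply: (@le_trans _ _ (\int[lebesgue_measure]_(x in `[0%R, (2 * pi)%R])
    (cc%:E * ((G 0 x)%:E + (G (t / 2) x)%:E + (G t x)%:E))%E)%E).
  apply: ge0_le_integral => //.
  - apply/measurable_EFinP; apply: (measurableT_comp (measurable_powR p)).
    by apply: measurableT_comp => //; apply: measurable_funTS.
  - apply: measurable_funeM; apply: emeasurable_funD; last exact: mGE.
    by apply: emeasurable_funD; exact: mGE.
  by move=> x _; rewrite -!EFinD -EFinM lee_fin.
rewrite ge0_integralZl_EFin//; last 2 first.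
- by move=> x _; rewrite -!EFinD lee_fin !addr_ge0.
- apply: emeasurable_funD; last exact: mGE.
  by apply: emeasurable_funD; exact: mGE.
rewrite ge0_integralD//; last 4 first.
- by move=> x _; rewrite -EFinD lee_fin addr_ge0.
- by apply: emeasurable_funD; exact: mGE.
- by move=> x _; rewrite lee_fin G0.
- exact: mGE.
rewrite ge0_integralD//; last 4 first.
- by move=> x _; rewrite lee_fin G0.
- exact: mGE.
- by move=> x _; rewrite lee_fin G0.
- exact: mGE.
set S := \sum_(i < M) _ in IG *.
have -> : cc * 3 * 32 * C * S = cc * (32 * C * S + 32 * C * S + 32 * C * S) by ring.
rewrite [leRHS]EFinM lee_wpmul2l ?lee_fin// !EFinD.
apply: leeD; first apply: leeD; apply: IG => //; rewrite ?normr0 ?ler01//.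
by rewrite normrM [`|2^-1|]ger0_norm//; have := normr_ge0 t; lra.
Qed.

(** * Partial sums and passage to the limit *)

Lemma sum_dyadic_split (R : realType) (F : nat -> R) M :
  \sum_(1 <= m < 2 ^ M) F m = \sum_(i < M) \sum_(2 ^ i <= m < 2 * 2 ^ i) F m.
Proof.
elim: M => [|M IH]; first by rewrite big_geq// big_ord0.
rewrite big_ord_recr/= -IH (big_cat_nat (n := 2 ^ M)) ?expn_gt0//= ?expnS//.
by rewrite leq_pmull.
Qed.

(** The partial sum over [1 <= m < N] of the cosine or sine series of [a]. *)
Definition tpsum (R : realType) (c : bool) (a : nat -> R) (N : nat) (x : R) : R :=
  \sum_(1 <= m < N) a m * trig c (m%:R * x).

Lemma continuous_trig (R : realType) c : continuous (@trig R c).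
Proof. by case: c => x; [exact: continuous_cos|exact: continuous_sin]. Qed.

Lemma measurable_tpsum (R : realType) c (a : nat -> R) N :
  measurable_fun [set: R] (tpsum c a N).
Proof.
apply: measurable_sum => m; apply: measurable_funM => //.
apply: continuous_measurable_fun => x.
apply: (@continuous_comp _ _ _ (fun x : R => m%:R * x) (trig c)).
  by apply: cvgM; [exact: cvg_cst|exact: cvg_id].
exact: continuous_trig.
Qed.

Lemma measurable_translate (R : realType) (t : R) (f : R -> R) :
  measurable_fun [set: R] f -> measurable_fun [set: R] (fun x => f (x + t)).
Proof. by move=> mf; apply: (measurableT_comp mf); exact: measurable_funD. Qed.

Lemma integral_tpsum_diff_le (R : realType) (p K : R) : 1 < p -> 0 <= K ->
  exists2 C : R, 0 <= C & forall (a : nat -> R) c n M (t : R),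
  (forall m, (1 <= m)%N -> 0 <= a m) ->
  (forall n, (1 <= n)%N ->
    \sum_(n <= m < (2 * n).+1) `|a m - a m.+1| <= K * (a n + a (2 * n)%N)) ->
  (1 <= n)%N -> `|t| <= n%:R^-1 ->
  (\int[lebesgue_measure]_(x in `[0%R, (2 * pi)%R])
     (`|tpsum c a (2 ^ M) (x + t) - tpsum c a (2 ^ M) x| `^ p)%:E <=
   (C * \sum_(1 <= k < 2 ^ M.+1) wterm p a n k)%:E)%E.
Proof.
move=> p1 K0.
have [C1 C10 H1] := integral_peak_sum_le p1.
have [C2 C20 H2] := nbvs_dyadic_sum_le p1 K0.
have D0 : 0 <= (3 * (1 + K)) `^ p by exact: powR_ge0.
exists (C1 * ((3 * (1 + K)) `^ p * C2)); first by rewrite !mulr_ge0.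
move=> a c n M t a0 aK n1 tn.
pose V i := lam R n (2 ^ i) * (a (2 ^ i)%N + a (2 * 2 ^ i)%N).
have V0 i : 0 <= V i.
  by rewrite mulr_ge0 ?lam_ge0// addr_ge0 ?a0 ?muln_gt0 ?expn_gt0.
have K3 : 0 <= 3 * (1 + K) by rewrite mulr_ge0// addr_ge0.
pose W i := 3 * (1 + K) * V i.
have W0 i : 0 <= W i by rewrite mulr_ge0.
have t1 : `|t| <= 1 by rewrite (le_trans tn)// invf_le1 ?ltr0n// ler1n.
apply: le_trans (H1 W M t _ W0 t1 _ _) _.
- apply: measurable_funB; last exact: measurable_tpsum.
  exact: measurable_translate (measurable_tpsum _ _ _).
- move=> x; rewrite /tpsum -sumrB sum_dyadic_split.
  rewrite (le_trans (ler_norm_sum _ _ _))//; apply: ler_sum => i _.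
  under eq_bigr do rewrite -mulrBr.
  by apply: norm_block_diff; rewrite ?expn_gt0.
rewrite lee_fin -mulrA ler_wpM2l//.
have -> : \sum_(i < M) W i `^ p * (2 ^+ i) `^ (p - 1) =
    (3 * (1 + K)) `^ p * \sum_(i < M) V i `^ p * (2 ^ i)%:R `^ (p - 1).
  rewrite mulr_sumr; apply: eq_bigr => i _.
  by rewrite /W powRM// natrX mulrA.
by rewrite -mulrA ler_wpM2l// H2.
Qed.

Lemma ae_translate (R : realType) (t : R) (P : R -> Prop) :
  {ae @lebesgue_measure R, forall x, P x} ->
  {ae @lebesgue_measure R, forall x, P (x + t)}.
Proof.
move=> [A [mA A0 PA]]; exists ((fun x : R => x + t) @^-1` A); split.
- rewrite -[X in measurable X]setTI.
  by apply: (_ : measurable_fun setT (fun x : R => x + t)) => //; exact: measurable_funD.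
- by rewrite lebesgue_measure_translate.
- by move=> x /= Px; exact: PA.
Qed.

(** Only lower semicontinuity of the power is needed, and it follows from the
    tangent inequality. *)
Lemma powR_limn_einf (R : realType) (p l : R) (u : nat -> R) :
  1 < p -> u @ \oo --> l ->
  ((`|l| `^ p)%:E <= limn_einf (fun M => (`|u M| `^ p)%:E))%E.
Proof.
move=> p1 ul.
pose v M : R := `|l| `^ p + p * `|l| `^ (p - 1) * (`|u M| - `|l|).
have vl : v @ \oo --> `|l| `^ p.
  rewrite -[X in _ --> X]addr0; apply: cvgD; first exact: cvg_cst.
  rewrite -[X in _ --> X](mulr0 (p * `|l| `^ (p - 1))); apply: cvgM; first exact: cvg_cst.
  rewrite -[X in _ --> X](subrr `|l|); apply: cvgB; last exact: cvg_cst.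
  exact: cvg_norm.
have vE : (fun M => (v M)%:E) @ \oo --> (`|l| `^ p)%:E.
  by apply: cvg_EFin => //; exact: nearW.
have [<- _] := cvg_limn_einf_sup vE.
rewrite !limn_einf_lim; apply: lee_lim; [exact: is_cvg_einfs|exact: is_cvg_einfs|].
apply: nearW => M; apply: le_ereal_inf_tmp => _ [k Mk <-].
apply: (@le_trans _ _ (v k)%:E); first by apply: ereal_inf_lbound; exists k.
by rewrite lee_fin powR_tangent.
Qed.

(** Fatou's lemma for [p]-th powers of a sequence converging almost
    everywhere. *)
Lemma integral_powR_cvg_le (R : realType) (p : R) (g_ : nat -> R -> R) (g : R -> R)
    (D : set R) (B : \bar R) :
  1 < p -> measurable D -> measurable_fun [set: R] g ->
  (forall M, measurable_fun [set: R] (g_ M)) ->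
  {ae @lebesgue_measure R, forall x, g_ ^~ x @ \oo --> g x} ->
  (forall M, (\int[lebesgue_measure]_(x in D) (`|g_ M x| `^ p)%:E <= B)%E) ->
  (\int[lebesgue_measure]_(x in D) (`|g x| `^ p)%:E <= B)%E.
Proof.
move=> p1 mD mg mg_ cvg_g HB.
have mpow (h : R -> R) : measurable_fun [set: R] h ->
    measurable_fun D (fun x => (`|h x| `^ p)%:E).
  move=> mh; apply: measurable_funTS; apply/measurable_EFinP.
  by apply: (measurableT_comp (measurable_powR p)); apply: measurableT_comp.
have mlim : measurable_fun D (fun x => limn_einf (fun M => (`|g_ M x| `^ p)%:E)).
  apply: measurableT_comp => //.
  apply: (@measurable_fun_limn_esup _ _ _ _ (fun M x => - (`|g_ M x| `^ p)%:E)%E).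
  by move=> M; apply: measurableT_comp => //; exact: mpow.
have lim0 x : (0 <= limn_einf (fun M => (`|g_ M x| `^ p)%:E))%E.
  rewrite limn_einf_lim; apply: lime_ge; first exact: is_cvg_einfs.
  apply: nearW => M; apply: le_ereal_inf_tmp => _ [k _ <-].
  by rewrite lee_fin powR_ge0.
apply: (@le_trans _ _ (\int[lebesgue_measure]_(x in D)
    limn_einf (fun M => (`|g_ M x| `^ p)%:E))%E).
  apply: ae_ge0_le_integral => //.
  - exact: mpow.
  have aeF := ae_filter_ringOfSetsType (@lebesgue_measure R).
  apply: (@filterS _ _ aeF _ _ _ cvg_g) => x gx _.
  exact: powR_limn_einf.
have fat := @fatou _ _ _ (@lebesgue_measure R) D mD
  (fun M x => (`|g_ M x| `^ p)%:E) (fun M => mpow _ (mg_ M))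
  (fun M x _ => powR_ge0 _ _).
apply: (le_trans fat).
rewrite limn_einf_lim; apply: lime_le; first exact: is_cvg_einfs.
apply: nearW => M; apply: le_trans (HB M).
by apply: ereal_inf_lbound; exists M => /=.
Qed.

(** * The modulus of continuity *)

Lemma wterm_lt (R : realType) (p : R) (a : nat -> R) n k : (1 <= k < n)%N ->
  0 <= a k ->
  wterm p a n k = n%:R `^ (- p) * (k%:R `^ (2 * p - 2) * a k `^ p).
Proof.
move=> /andP[k1 kn] ak.
have k0 : 0 < k%:R :> R by rewrite ltr0n.
have n0 : 0 < n%:R :> R by rewrite ltr0n (leq_trans k1 (ltnW kn)).
rewrite /wterm /lam min_l; last by rewrite ler_pdivrMr// mul1r ler_nat ltnW.
rewrite !powRM ?invr_ge0 ?divr_ge0 ?ler0n// -powR_inv1 ?ler0n// -powRrM mulN1r.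
have -> : 2 * p - 2 = (p - 2) + p by ring.
rewrite [X in _ = _ * (X * _)]powRD; last by rewrite (gt_eqF k0) implybT.
ring.
Qed.

Lemma wterm_ge (R : realType) (p : R) (a : nat -> R) n k : (1 <= n <= k)%N ->
  wterm p a n k = k%:R `^ (p - 2) * a k `^ p.
Proof.
move=> /andP[n1 nk]; rewrite /wterm /lam min_r ?mul1r//.
by rewrite ler_pdivlMr ?ltr0n// mul1r ler_nat.
Qed.

(** The two sums of the theorem are the parts [k < n] and [n <= k] of the sum of
    [wterm]. *)
Lemma wterm_sum_le (R : realType) (p : R) (a : nat -> R) n N :
  (forall m, (1 <= m)%N -> 0 <= a m) -> (1 <= n)%N ->
  ((\sum_(1 <= k < N) wterm p a n k)%:E <=
   (n%:R `^ (- p) * \sum_(1 <= v < n) v%:R `^ (2 * p - 2) * a v `^ p)%:E +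
   \sum_(n <= v <oo) (v%:R `^ (p - 2) * a v `^ p)%:E)%E.
Proof.
move=> a0 n1.
have w0 k : 0 <= wterm p a n k by rewrite mulr_ge0 ?powR_ge0.
apply: (@le_trans _ _ (\sum_(1 <= k < n + N) wterm p a n k)%:E).
  rewrite lee_fin; have [N1|N1] := leqP 1 N; last first.
    by rewrite big_geq ?(ltnW N1)// sumr_ge0.
  by rewrite [leRHS](big_cat_nat N1 (leq_addl _ _))/= lerDl sumr_ge0.
rewrite (big_cat_nat n1 (leq_addr _ _))/= EFinD; apply: leeD.
  rewrite lee_fin mulr_sumr [leLHS]big_nat [leRHS]big_nat.
  by apply: ler_sum => k kn; rewrite wterm_lt// a0//; case/andP: kn.
apply: le_trans (@nneseries_lim_ge R
  (fun v => (v%:R `^ (p - 2) * a v `^ p)%:E) xpredT n (n + N) _); last first.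
  by move=> v _ _; rewrite lee_fin mulr_ge0 ?powR_ge0.
rewrite sumEFin lee_fin [leLHS]big_nat [leRHS]big_nat.
by apply: ler_sum => k /andP[nk _]; rewrite wterm_ge ?n1.
Qed.

(** The estimate of the theorem raised to the power [p], for a single shift [t]. *)
Lemma integral_diff_le (R : realType) (p K : R) : 1 < p -> 0 <= K ->
  exists2 C : R, 0 < C & forall (a : nat -> R) c n (f : R -> R) (t : R),
  (forall m, (1 <= m)%N -> 0 <= a m) ->
  (forall n, (1 <= n)%N ->
    \sum_(n <= m < (2 * n).+1) `|a m - a m.+1| <= K * (a n + a (2 * n)%N)) ->
  measurable_fun [set: R] f ->
  {ae @lebesgue_measure R, forall x, (fun N => tpsum c a N.+1 x) @ \oo --> f x} ->
  (1 <= n)%N -> `|t| <= n%:R^-1 ->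
  (\int[lebesgue_measure]_(x in `[0%R, (2 * pi)%R]) (`|f (x + t) - f x| `^ p)%:E <=
   C%:E * ((n%:R `^ (- p) * \sum_(1 <= v < n) v%:R `^ (2 * p - 2) * a v `^ p)%:E +
   \sum_(n <= v <oo) (v%:R `^ (p - 2) * a v `^ p)%:E))%E.
Proof.
move=> p1 K0; have [C C0 HC] := integral_tpsum_diff_le p1 K0.
exists (C + 1); first by rewrite ltr_wpDl.
move=> a c n f t a0 aK mf cvgf n1 tn.
set B := (X in (_ <= _ * X)%E).
have B0 : (0 <= B)%E.
  rewrite adde_ge0//.
    by rewrite lee_fin mulr_ge0 ?powR_ge0// sumr_ge0// => k _; rewrite mulr_ge0 ?powR_ge0.
  by apply: nneseries_ge0 => k _ _; rewrite lee_fin mulr_ge0 ?powR_ge0.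
have cvg2 : {ae @lebesgue_measure R, forall x,
    (fun M => tpsum c a (2 ^ M) x) @ \oo --> f x}.
  have aeF := ae_filter_ringOfSetsType (@lebesgue_measure R).
  apply: (@filterS _ _ aeF _ _ _ cvgf) => x fx.
  have pw : (fun M => (2 ^ M).-1) @ \oo --> \oo.
    apply/cvgnyPge => A; near=> M; apply: (@leq_trans M).
      by near: M; exact: nbhs_infty_ge.
    by rewrite -ltnS prednK ?expn_gt0// ltn_expl.
  have -> : (fun M => tpsum c a (2 ^ M) x) =
      (fun N => tpsum c a N.+1 x) \o (fun M => (2 ^ M).-1).
    by apply/funext => M /=; rewrite prednK ?expn_gt0.
  exact: cvg_comp pw fx.
have cvgt := ae_translate t cvg2.
apply: (@integral_powR_cvg_le _ p
  (fun M x => tpsum c a (2 ^ M) (x + t) - tpsum c a (2 ^ M) x)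
  (fun x => f (x + t) - f x)) => //.
- by apply: measurable_funB => //; exact: measurable_translate.
- move=> M; apply: measurable_funB; last exact: measurable_tpsum.
  exact: measurable_translate (measurable_tpsum _ _ _).
- have aeF := ae_filter_ringOfSetsType (@lebesgue_measure R).
  apply: (@filterS2 _ _ aeF _ _ _ _ cvg2 cvgt) => x fx ftx.
  exact: cvgB.
move=> M; apply: (le_trans (HC a c n M t a0 aK n1 tn)).
rewrite EFinM; apply: (@le_trans _ _ ((C + 1)%:E *
    (\sum_(1 <= k < 2 ^ M.+1) wterm p a n k)%:E)%E).
  rewrite -!EFinM lee_fin ler_wpM2r ?lerDl//.
  by apply: sumr_ge0 => k _; rewrite mulr_ge0 ?powR_ge0.
apply: lee_wpmul2l; first by rewrite lee_fin addr_ge0.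
exact: wterm_sum_le.
Unshelve. all: by end_near.
Qed.

Lemma norm2piE (R : realType) (p : R) (g : R -> R) : 0 < p ->
  norm2pi p g =
  ((\int[lebesgue_measure]_(x in `[0%R, (2 * pi)%R]) (`|g x| `^ p)%:E) `^ p^-1)%E.
Proof.
move=> p0; rewrite /norm2pi unlock /Lnorm; congr (_ `^ _)%E.
rewrite [RHS]integral_mkcond; apply: eq_integral => x _.
rewrite !patchE; case: ifP => _ //.
by rewrite abse0 poweR0r// gt_eqF.
Qed.

Lemma poweR_add_le (R : realType) (r : R) (x y : \bar R) : 0 < r ->
  (0 <= x)%E -> (0 <= y)%E ->
  ((x + y) `^ r <= (2 `^ r)%:E * (x `^ r + y `^ r))%E.
Proof.
move=> r0; have c0 : 0 < 2 `^ r by rewrite powR_gt0.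
have rn : r != 0 by rewrite gt_eqF.
case: x => [x| |]//; case: y => [y| |]// x0 y0.
- by rewrite -EFinD !poweR_EFin -EFinD -EFinM lee_fin powR_add_le// ltW.
- by rewrite poweRyr// addey// mulry gtr0_sg// mul1e leey.
- by rewrite poweRyr// addye// mulry gtr0_sg// mul1e leey.
- by rewrite poweRyr// addye// mulry gtr0_sg// mul1e leey.
Qed.

Theorem theorem1 (R : realType) (p : R) (a : nat -> R)
    (hp : 1 < p)
    (ha : NBVS a)
    (hsum : (\sum_(1 <= n <oo) (n%:R `^ (p - 2) * a n `^ p)%:E < +oo)%E) :
  exists K1 K2 : R, [/\ 0 < K1, 0 < K2 &
    forall f : R -> R,
      measurable_fun [set: R] f -> periodic2pi f ->
      is_sum_cos a f \/ is_sum_sin a f ->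
      forall n : nat, (1 <= n)%N ->
        (modulus p f n%:R^-1 <=
           (K1 * n%:R^-1 *
              (\sum_(1 <= v < n) v%:R `^ (2 * p - 2) * a v `^ p) `^ p^-1)%:E
           + K2%:E *
              (\sum_(n <= v <oo) (v%:R `^ (p - 2) * a v `^ p)%:E) `^ p^-1)%E].
Proof.
have p0 : 0 < p := lt_trans ltr01 hp.
have ip0 : 0 < p^-1 by rewrite invr_gt0.
have [a0 [K aK]] := ha.
have aK' n : (1 <= n)%N ->
    \sum_(n <= m < (2 * n).+1) `|a m - a m.+1| <= `|K| * (a n + a (2 * n)%N).
  move=> n1; apply: (le_trans (aK n n1)); rewrite ler_wpM2r ?ler_norm//.
  by rewrite addr_ge0 ?a0 ?muln_gt0.
have [C C0 HC] := integral_diff_le hp (normr_ge0 K).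
pose k : R := C `^ p^-1 * 2 `^ p^-1.
have k0 : 0 < k by rewrite mulr_gt0 ?powR_gt0.
exists k, k; split=> // f mf _ fsum n n1.
have [c cvgf] : exists c,
    {ae @lebesgue_measure R, forall x, (fun N => tpsum c a N.+1 x) @ \oo --> f x}.
  by case: fsum => h; [exists true|exists false].
apply: ge_ereal_sup => _ [t /= tn <-].
rewrite norm2piE//.
have H := HC a c n f t a0 aK' mf cvgf n1 tn.
set X := \sum_(1 <= v < n) _ in H *.
set Y := (\sum_(n <= v <oo) _)%E in H *.
have X0 : 0 <= X by apply: sumr_ge0 => v _; rewrite mulr_ge0 ?powR_ge0.
have Y0 : (0 <= Y)%E.
  by apply: nneseries_ge0 => v _ _; rewrite lee_fin mulr_ge0 ?powR_ge0.
have u0 : (0 <= (n%:R `^ (- p) * X)%:E)%E by rewrite lee_fin mulr_ge0 ?powR_ge0.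
set I := (\int[_]_(_ in _) _)%E in H *.
have I0 : (0 <= I)%E by apply: integral_ge0 => x _; rewrite lee_fin powR_ge0.
apply: (@le_trans _ _ ((C%:E * ((n%:R `^ (- p) * X)%:E + Y)) `^ p^-1)%E).
  apply: gt0_ler_poweR => //; first exact: ltW.
  - by rewrite in_itv/= leey andbT.
  - by rewrite in_itv/= leey andbT mule_ge0 ?adde_ge0// lee_fin ltW.
rewrite poweRM ?adde_ge0 ?lee_fin ?(ltW C0)// poweR_EFin.
have cE0 : (0 <= (C `^ p^-1)%:E)%E by rewrite lee_fin powR_ge0.
apply: (le_trans (lee_wpmul2l cE0 (poweR_add_le ip0 u0 Y0))).
rewrite muleA -EFinM -/k poweR_EFin powRM ?powR_ge0//.
rewrite -powRrM mulNr divff ?gt_eqF// powR_inv1//.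
rewrite ge0_muleDr ?poweR_ge0 ?lee_fin ?mulr_ge0 ?powR_ge0 ?invr_ge0//.
by rewrite -EFinM mulrA.
Qed.
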